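(* Let $S$ be a set of primes and $r$ a positive integer, and assume $\{a_n(q)\}_{n\ge1}\subseteq\mathbb{Z}[q]$ satisfies the $q$-Gauss congruences of order $r$ with respect to $S$. Let $n \ge 2$, $m \ge 1$ be integers with $n \in \mathbb{N}_S$, and let $p$ be the smallest prime divisor of $n$. For $0 \le i \le r-1$ define $g_i : D_n \to \mathbb{C}$ by $g_i(d) = (\omega_n^d)^i a_{mn}^{(i)}(\omega_n^d)$. Then for $0 \le i \le \min\{p-2, r-1\}$ the $i$-th $[n]_q$-digit $f_i(q)$ of $a_{mn}(q)$ is given recursively by $$f_i(q) = \frac{1}{i!\,n^i}\Big((q-1)^i G_{g_i,n}(q) - \sum_{m_1=0}^{i-1}\sum_{m_2=m_1}^{i} \binom{i}{m_2} f_{m_1}^{(i-m_2)}(q)\, R_{n,m_1,m_2}(q)\,(q-1)^{i-m_2} q^{i-m_2}\Big).$$ Moreover $f_i(q)$ is divisible by $q-1$ for $1 \le i \le \min\{p-2,r-1\}$, and $$\sum_{d \mid n} \mu\!\left(\tfrac{n}{d}\right) a_{md}(1) \equiv 0 \pmod{n^{1+\min\{p-2,r-1\}}}.$$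
   Context: $[n]_q = \frac{q^n-1}{q-1}$; $\mu$ is the Möbius function; $\omega_n = e^{2\pi i/n}$, $\mu_n=\{\omega_n^j : j\in\mathbb{Z}\}$, $\mathrm{ord}(\omega)$ is the order of a root of unity $\omega$; $f^{(j)}$ denotes the $j$-th derivative in $q$. For a set $S$ of primes, $\mathbb{N}_S$ is the set of positive integers all of whose prime divisors lie in $S$. A sequence $\{a_n(q)\}\subseteq\mathbb{Z}[q]$ satisfies the $q$-Gauss congruences with respect to $S$ if for all $n \in \mathbb{N}_S$ and $m\ge1$, $\sum_{d\mid n}\mu(d)a_{nm/d}(q^d)$ is divisible by $[n]_q$ in $\mathbb{Z}[q]$; it satisfies them of order $r$ with respect to $S$ if moreover for all $m\ge1$, $n\in\mathbb{N}_S$, $1\le j\le r-1$, the function $\mu_n\to\mathbb{C}$, $\omega\mapsto\omega^j a_{nm}^{(j)}(\omega)$ depends only on $\mathrm{ord}(\omega)$. $D_n$ is the set of divisors $d$ of $n$ with $d\ne n$; for $g: D_n\to\mathbb{C}$, $G_{g,n}(q) = \sum_{d\in D_n}\frac{[n]_q}{[n/d]_q}\cdot\frac{\sum_{e\mid d}\mu(d/e)g(e)}{d}$. For $F\in\mathbb{C}[q]$ and $n>1$, writing uniquely $F(q)=\sum_{i\ge0} f_i(q)[n]_q^i$ with $\deg f_i < n-1$, $f_i$ is the $i$-th $[n]_q$-digit of $F$. For $n\ge1$, $i\ge0$: $P_{n,i}(t) = i!\sum_{j=\max(0,i-n)}^{i-1}\binom{n}{i-j}(-t)^j(t-1)^{i-j-1}$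 (so $P_{n,0}=0$), and for $i,j\ge0$: $R_{n,i,j}(t)=\sum_{a_1+\cdots+a_i=j,\ a_k\ge0}\binom{j}{a_1,\ldots,a_i}\prod_{k=1}^i P_{n,a_k}(t)$, with $R_{n,0,j}=1$ if $j=0$ and $0$ otherwise. *)

(* Defs.v *)
(* The field of complex numbers is R[i], for R : realType. *)
From HB Require Import structures.
From mathcomp Require Import all_boot all_order all_algebra.
From mathcomp Require Import reals trigo complex.
Set Implicit Arguments.
Unset Strict Implicit.
Unset Printing Implicit Defensive.
Import Order.TTheory GRing.Theory Num.Theory.
Local Open Scope ring_scope.
Local Open Scope complex_scope.

(* Only meaningful for n > 0; the value at n = 0 is never used. *)
Definition mobius (n : nat) : int :=
  if all (fun p => logn p n == 1%N) (primes n)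
  then (-1) ^+ size (primes n) else 0.

(* [n]_q = 1 + q + ... + q^(n-1), see qintE. *)
Definition qint (A : nzRingType) (n : nat) : {poly A} := \sum_(i < n) 'X^i.

Lemma qintE (A : comNzRingType) n : ('X - 1) * qint A n = 'X^n - 1.
Proof. by rewrite /qint subrX1. Qed.

Lemma monic_qint (A : nzRingType) n : (0 < n)%N ->
  (qint A n \is monic) /\ size (qint A n) = n.
Proof.
move=> n_gt0.
have -> : qint A n = \poly_(i < n) 1.
  by rewrite poly_def; apply: eq_bigr => i _; rewrite scale1r.
have nz : (1 : A) != 0 by rewrite oner_eq0.
by split; [rewrite monicE lead_coef_poly | rewrite size_poly_eq].
Qed.

(* a 0 is a junk value, never used.  Divisibility is in Z[q]. *)
Definition q_gauss (S : nat_pred) (a : nat -> {poly int}) : Prop :=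
  forall n m : nat, S.-nat n -> (0 < m)%N ->
  exists h : {poly int},
    \sum_(d <- divisors n) mobius d *: (a (n * m %/ d)%N \Po 'X^d)
    = qint int n * h.

Definition omega (R : realType) (n : nat) : R[i] :=
  cos (2 * pi / n%:R) +i* sin (2 * pi / n%:R).

Definition in_mu (R : realType) (n : nat) (w : R[i]) : Prop :=
  exists j : int, w = omega R n ^ j.

Definition polyC_of (R : realType) (f : {poly int}) : {poly R[i]} :=
  map_poly intr f.

(* k.-primitive_root w says that w is a root of unity with ord w = k. *)
Definition q_gauss_order (R : realType) (r : nat) (S : nat_pred)
    (a : nat -> {poly int}) : Prop :=
  q_gauss S a /\
  forall m n j : nat, (0 < m)%N -> S.-nat n -> (1 <= j <= r - 1)%N ->
  forall (k : nat) (w1 w2 : R[i]), in_mu n w1 -> in_mu n w2 ->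
    k.-primitive_root w1 -> k.-primitive_root w2 ->
    w1 ^+ j * (polyC_of R (a (n * m)%N))^`(j).[w1] =
    w2 ^+ j * (polyC_of R (a (n * m)%N))^`(j).[w2].

Definition proper_divisors (n : nat) : seq nat :=
  [seq d <- divisors n | d != n].

(* g matters only on proper_divisors n; the polynomial quotient is exact. *)
Definition Gpoly (R : realType) (g : nat -> R[i]) (n : nat) : {poly R[i]} :=
  \sum_(d <- proper_divisors n)
    ((\sum_(e <- divisors d) (mobius (d %/ e))%:~R * g e) / d%:R)
      *: (qint R[i] n %/ qint R[i] (n %/ d)%N).

(* Such f exists and is unique: is_qdigits_exists, is_qdigits_unique.
   The bound size (f i) < n is deg (f i) < n - 1. *)
Definition is_qdigits (F : fieldType) (n : nat) (P : {poly F})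
    (f : nat -> {poly F}) : Prop :=
  (forall i, (size (f i) < n)%N) /\
  exists N : nat, (forall i, (N <= i)%N -> f i = 0) /\
    P = \sum_(i < N) f i * qint F n ^+ i.

Lemma is_qdigits_exists (F : fieldType) n (P : {poly F}) : (1 < n)%N ->
  exists f, is_qdigits n P f.
Proof.
move=> n_gt1; have [q_monic sz_q] := monic_qint F (ltnW n_gt1).
have q_nz := monic_neq0 q_monic.
elim: {P}(size P) {-2}P (leqnn (size P)) => [|s IHs] P.
  rewrite leqn0 size_poly_eq0 => /eqP->.
  exists (fun=> 0); split=> [i|]; first by rewrite size_poly0 ltnW.
  by exists 0%N; rewrite big_ord0.
move=> sP; have sz_div : (size (P %/ qint F n)%R <= s)%N.
  rewrite size_divp // sz_q leq_subLR (leq_trans sP) // -addn1 addnC leq_add2r.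
  by rewrite -subn1 subn_gt0.
have [f [szf [N [f0 Pf]]]] := IHs _ sz_div.
exists (fun i => if i is j.+1 then f j else P %% qint F n); split.
  by case=> [|i] //; rewrite -{2}sz_q ltn_modp.
exists N.+1; split; first by case=> [|i] //; rewrite ltnS => /f0.
rewrite big_ord_recl expr0 mulr1 {1}(divp_eq P (qint F n)) addrC; congr (_ + _).
by rewrite Pf mulr_suml; apply: eq_bigr => i _; rewrite exprSr mulrA.
Qed.

Lemma is_qdigits_unique (F : fieldType) n (P : {poly F}) f g : (1 < n)%N ->
  is_qdigits n P f -> is_qdigits n P g -> forall i, f i = g i.
Proof.
move=> n_gt1; have [q_monic sz_q] := monic_qint F (ltnW n_gt1).
have q_nz := monic_neq0 q_monic.
have step P' h : is_qdigits n P' h ->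
  h 0%N = P' %% qint F n /\ is_qdigits n (P' %/ qint F n) (h \o S).
  case=> szh [N [h0 P'h]].
  have P'E : P' = (\sum_(i < N) h i.+1 * qint F n ^+ i) * qint F n + h 0%N.
    have -> : P' = \sum_(i < N.+1) h i * qint F n ^+ i.
      by rewrite big_ord_recr /= -P'h h0 // mul0r addr0.
    rewrite big_ord_recl expr0 mulr1 addrC mulr_suml; congr (_ + _).
    by apply: eq_bigr => i _; rewrite exprSr mulrA.
  have sz0 : (size (h 0%N) < size (qint F n))%N by rewrite sz_q.
  split; first by rewrite P'E modpD modp_mull add0r modp_small.
  split=> [i|]; first exact: szh.
  exists N; split=> [i Ni|]; first exact/h0/leqW.
  by rewrite {1}P'E divpD mulpK // (divp_small sz0) addr0.
move=> Pf Pg i; elim: i P f g Pf Pg => [|i IHi] P f g /step[f0 Pf] /step[g0 Pg].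
  by rewrite f0 g0.
exact: (IHi _ _ _ Pf Pg).
Qed.

(* The lower bound max(0, i - n) is the truncated subtraction i - n. *)
Definition Ppoly (A : comNzRingType) (n i : nat) : {poly A} :=
  i`!%:R * \sum_((i - n)%N <= j < i)
    'C(n, i - j)%:R * (- 'X) ^+ j * ('X - 1) ^+ (i - j - 1)%N.

Definition multinomial (i j : nat) (a : 'I_i -> nat) : nat :=
  (j`! %/ \prod_(k < i) (a k)`!)%N.

(* Parts of a composition of j are at most j, hence the finite type 'I_j.+1. *)
Definition Rpoly (A : comNzRingType) (n i j : nat) : {poly A} :=
  \sum_(a : {ffun 'I_i -> 'I_j.+1} | \sum_(k < i) (a k : nat) == j)
    (multinomial j (fun k => a k))%:R * \prod_(k < i) Ppoly A n (a k).

(* Main.v *)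
(** The q-Gauss congruences say that a_(mn) takes the value a_(md)(1) at the
    roots of unity w of order n/d; with the order-r hypothesis, the values of
    q^i a_(mn)^(i) at w depend only on the order of w for every i < r, so
    G_(g_i,n), which takes the value g_i(gcd(j,n)) at omega_n^j, interpolates
    them at the nontrivial n-th roots of unity.  Expanding
    a_(mn) = sum_k f_k [n]^k at q = w + w(w-1)X, the coefficients of [n]^k
    become the values of R_(n,k,j)(w) / j!, so the coefficient of X^i shows
    that both sides of the recursion agree at these n-1 points.  Both sides
    also have degree at most n-p+i, which is less than n-1 as long as
    i <= p-2, hence they are equal.  Evaluating at q = 1 kills the digits
    1, ..., min(p-2, r-1).  The digits have integer coefficients, and by
    Moebius inversion f_0(1) = G_(g_0,n)(1) is a_(mn)(1) minus the sum of the
    mu(n/d) a_(md)(1), so the last congruence follows from [n]_1 = n. *)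
Require Import Defs.
From HB Require Import structures.
From mathcomp Require Import all_boot all_order all_algebra.
From mathcomp Require Import reals trigo complex.
From mathcomp Require Import zify ring lra.
Set Implicit Arguments.
Unset Strict Implicit.
Unset Printing Implicit Defensive.
Import Order.TTheory GRing.Theory Num.Theory.
Local Open Scope ring_scope.
Local Open Scope complex_scope.

(** * Divisor sums and Möbius inversion *)

Lemma big_divisors_dvd (V : nmodType) (e n : nat) (F : nat -> V) :
  (0 < n)%N -> (e %| n)%N ->
  \sum_(d <- divisors n | (e %| d)%N) F d =
  \sum_(d <- divisors (n %/ e)) F (e * d)%N.
Proof.
move=> n_gt0 e_n; have e_gt0 := dvdn_gt0 n_gt0 e_n.
have ne_gt0 : (0 < n %/ e)%N by rewrite divn_gt0 // dvdn_leq.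
rewrite -big_filter -(big_map (muln e) predT F); apply: perm_big.
apply: uniq_perm; first by rewrite filter_uniq ?divisors_uniq.
  rewrite map_inj_uniq ?divisors_uniq // => x y /eqP.
  by rewrite eqn_pmul2l // => /eqP.
move=> d; rewrite mem_filter -dvdn_divisors //; apply/andP/mapP.
  case=> e_d d_n; exists (d %/ e)%N; last by rewrite mulnC divnK.
  by rewrite -dvdn_divisors // -(dvdn_pmul2r e_gt0) !divnK.
case=> x; rewrite -dvdn_divisors // => x_ne ->; split; first exact: dvdn_mulr.
by rewrite -(divnK e_n) mulnC dvdn_pmul2r.
Qed.

Lemma mobius1 : mobius 1 = 1.
Proof. by []. Qed.

Lemma mobius_sq_dvd p d : prime p -> (0 < d)%N -> (p ^ 2 %| d)%N ->
  mobius d = 0.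
Proof.
move=> p_pr d_gt0 p2d; rewrite /mobius; case: ifP => // /allP /(_ p).
have p_d : (p %| d)%N by apply: dvdn_trans p2d; rewrite dvdn_mulr.
rewrite mem_primes p_pr d_gt0 p_d => /(_ isT) /eqP lp.
by move: p2d; rewrite pfactor_dvdn // lp.
Qed.

Lemma mobius_prime_mul p d : prime p -> (0 < d)%N -> ~~ (p %| d)%N ->
  mobius (p * d) = - mobius d.
Proof.
move=> p_pr d_gt0 p_d; have p_gt0 := prime_gt0 p_pr.
have p_nd : p \notin primes d by rewrite mem_primes p_pr d_gt0.
have pe : perm_eq (primes (p * d)) (p :: primes d).
  apply: uniq_perm; rewrite /= ?primes_uniq ?p_nd // => q.
  by rewrite primesM // primes_prime // !inE.
rewrite /mobius (perm_all _ pe) (perm_size pe) /= exprS mulN1r.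
have -> : logn p (p * d) = 1%N.
  by rewrite lognM // logn_prime // eqxx lognE (negPf p_d) !andbF.
have -> : all (fun q => logn q (p * d) == 1%N) (primes d) =
          all (fun q => logn q d == 1%N) (primes d).
  apply: eq_in_all => q q_d; rewrite lognM // logn_prime //.
  by case: (eqVneq q p) q_d => [->|//]; rewrite (negPf p_nd).
by rewrite eqxx /=; case: ifP; rewrite ?oppr0.
Qed.

(* Pair each divisor [d] prime to [p] with [p * d]. *)
Lemma sum_mobius n : (0 < n)%N ->
  \sum_(d <- divisors n) mobius d = (n == 1%N)%:R.
Proof.
move=> n_gt0; have [->|n_neq1] := eqVneq n 1%N.
  by rewrite (_ : divisors 1 = [:: 1%N]) // big_seq1.
have p_pr : prime (pdiv n) by rewrite pdiv_prime //; lia.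
move: (pdiv n) (pdiv_dvd n) p_pr => p p_n p_pr.
have p_gt0 := prime_gt0 p_pr.
have np_gt0 : (0 < n %/ p)%N by rewrite divn_gt0 // dvdn_leq.
rewrite (bigID (fun d => (p %| d)%N)) /= big_divisors_dvd //.
rewrite (bigID (fun d => (p %| d)%N)) /= big_seq_cond big1 ?add0r; last first.
  move=> d /andP[]; rewrite -dvdn_divisors // => d_np p_d.
  apply: (mobius_sq_dvd p_pr).
    by rewrite muln_gt0 p_gt0 (dvdn_gt0 np_gt0).
  by rewrite expnS expn1 dvdn_pmul2l.
rewrite big_seq_cond (eq_bigr (fun d => - mobius d)); last first.
  move=> d /andP[]; rewrite -dvdn_divisors // => d_np p_d.
  by rewrite mobius_prime_mul // (dvdn_gt0 np_gt0).
rewrite -big_seq_cond sumrN -[X in - X]big_filter -[X in _ + X]big_filter.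
apply/eqP; rewrite addrC subr_eq0; apply/eqP/perm_big.
(* Both sums now range over divisors prime to [p], and such a [d] divides [n] exactly when it
   divides [n %/ p]. *)
apply: uniq_perm; rewrite ?filter_uniq ?divisors_uniq // => d.
rewrite !mem_filter -!dvdn_divisors //; case: (boolP (p %| d)%N) => //= p_d.
rewrite -{1}(divnK p_n) Gauss_dvdl // coprime_sym prime_coprime //.
Qed.

(** After exchanging the sums, [g e] is weighted by the sum of [mobius] over the divisors of
    [n %/ e], which vanishes unless [e = n]. *)
Lemma mobius_inversion (A : comNzRingType) (g : nat -> A) n : (0 < n)%N ->
  \sum_(d <- divisors n) \sum_(e <- divisors d) (mobius (d %/ e)%N)%:~R * g e
  = g n.
Proof.
move=> n_gt0.
transitivity (\sum_(d <- divisors n) \sum_(e <- divisors n | (e %| d)%N)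
   (mobius (d %/ e)%N)%:~R * g e).
  rewrite big_seq [RHS]big_seq; apply: eq_bigr => d.
  rewrite -dvdn_divisors // => d_n; rewrite -[RHS]big_filter; apply: perm_big.
  apply: uniq_perm; rewrite ?filter_uniq ?divisors_uniq // => e.
  rewrite mem_filter -!dvdn_divisors // ?(dvdn_gt0 n_gt0) //.
  by case: (boolP (e %| d)%N) => //= /dvdn_trans->.
rewrite (exchange_big_dep predT) //=.
rewrite (bigD1_seq n) ?divisors_uniq ?divisors_id //=.
have E e : (e %| n)%N ->
  \sum_(d <- divisors n | (e %| d)%N) (mobius (d %/ e)%N)%:~R * g e
  = (e == n)%:R * g e.
  move=> e_n; rewrite -mulr_suml -rmorph_sum /= big_divisors_dvd //.
  have e_gt0 := dvdn_gt0 n_gt0 e_n.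
  have -> : (e == n) = (n %/ e == 1)%N by rewrite [RHS]eq_sym eqn_div // mul1n.
  have ne_gt0 : (0 < n %/ e)%N by rewrite divn_gt0 // dvdn_leq.
  under eq_bigr do rewrite mulKn //.
  rewrite (sum_mobius ne_gt0).
  by case: (_ == _).
rewrite E // eqxx mul1r big_seq_cond big1 ?addr0 // => e /andP[].
by rewrite -dvdn_divisors // => e_n /negPf ne; rewrite E // ne mul0r.
Qed.

(** * Roots of unity and values of $[n]_q$ *)

Lemma omega_expn (R : realType) n k :
  omega R n ^+ k =
  cos (k%:R * (2 * pi / n%:R)) +i* sin (k%:R * (2 * pi / n%:R)).
Proof.
rewrite /omega; move: (2 * pi / n%:R) => x.
elim: k => [|k IHk]; first by rewrite expr0 mul0r cos0 sin0.
rewrite exprS IHk -nat1r mulrDl mul1r cosD sinD.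
by apply/eqP; rewrite eq_complex /= eqxx /= addrC.
Qed.

(** Half angles: if a power $0 < k < n$ gave 1, then $\cos 2x = 1$ for $x = k\pi/n$, hence $\sin x =
    0$, although $0 < x < \pi$. *)
Lemma omega_prim (R : realType) n :
  (0 < n)%N -> n.-primitive_root (omega R n).
Proof.
move=> n_gt0; apply/andP; split=> //; apply/forallP => k.
have nR_gt0 : 0 < n%:R :> R by rewrite ltr0n.
rewrite unity_rootE omega_expn; have [E|k_neq] := eqVneq k.+1 n.
  have -> : k.+1%:R * (2 * pi / n%:R) = pi *+ 2 :> R.
    by rewrite E mulr2n; field; rewrite gt_eqF.
  by rewrite cos2pi sin2pi; apply/eqP; rewrite eq_complex /= !eqxx.
have lt_kn : (k.+1 < n)%N by rewrite ltn_neqAle k_neq ltn_ord.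
apply/eqP; rewrite eq_complex /=; apply/negP => /andP[/eqP cos1 _].
pose x : R := k.+1%:R * pi / n%:R.
have x2 : k.+1%:R * (2 * pi / n%:R) = x *+ 2 by rewrite /x mulr2n; ring.
move: cos1; rewrite x2 cos_mulr2n cos2sin2 => cos1.
have /eqP : sin x ^+ 2 = 0 by move: cos1; rewrite mulr2n; lra.
rewrite sqrf_eq0 gt_eqF // sin_gt0_pi // /x.
rewrite divr_gt0 ?mulr_gt0 ?pi_gt0 ?ltr0n //=.
by rewrite ltr_pdivrMr // mulrC ltr_pM2l ?pi_gt0 // ltr_nat.
Qed.

Lemma qint_horner (A : comNzRingType) n (x : A) :
  (x - 1) * (qint A n).[x] = x ^+ n - 1.
Proof.
have := congr1 (horner^~ x) (qintE A n).
by rewrite !hornerE.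
Qed.

Lemma qint_root (F : fieldType) n (x : F) :
  x ^+ n = 1 -> x != 1 -> (qint F n).[x] = 0.
Proof.
move=> xn x1; apply/eqP; move: (qint_horner n x); rewrite xn subrr => /eqP.
by rewrite mulf_eq0 subr_eq0 (negPf x1).
Qed.

Lemma qint_horner1 (A : nzRingType) n : (qint A n).[1] = n%:R.
Proof.
rewrite /qint horner_sum (eq_bigr (fun=> 1)) => [|i _].
  by rewrite sumr_const card_ord.
by rewrite hornerXn expr1n.
Qed.

Lemma map_qint (A : nzRingType) n :
  map_poly (intr : int -> A) (qint int n) = qint A n.
Proof. by rewrite rmorph_sum; apply: eq_bigr => i _; rewrite /= map_polyXn. Qed.

(** Multiplied by the regular element $X - 1$, both sides become $X^{kn} - 1$. *)
Lemma qint_comp (A : comNzRingType) k n :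
  qint A (k * n) = qint A k * (qint A n \Po 'X^k).
Proof.
have rX : GRing.lreg ('X - 1 : {poly A}).
  by apply: monic_lreg; rewrite -['X - 1]/('X - 1%:P) monicXsubC.
apply: rX; rewrite mulrA !qintE; apply/esym.
have := congr1 (comp_poly 'X^k) (qintE A n).
rewrite rmorphM !rmorphB /= comp_polyX rmorph1 /= rmorphXn /= comp_polyX.
by rewrite -exprM.
Qed.

(** Strong induction on [n]. For [w != 1] the factor $[n]$ vanishes at [w], so $\sum_{d \mid n}
    \mu(d)\, a_{nm/d}(w^d) = 0$. For $d > 1$ the root $w^d$ has order $n/d$ and the induction
    hypothesis gives the value $a_m(1)$. As $\sum_{d \mid n} \mu(d) = 0$, the term $d = 1$ has this
    value as well. *)
Lemma q_gauss_value (F : fieldType) (S : nat_pred) a n m (w : F) :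
  q_gauss S a -> S.-nat n -> (0 < m)%N -> n.-primitive_root w ->
  (map_poly intr (a (n * m)%N)).[w] = (a m).[1]%:~R.
Proof.
move=> ga; have [k] := ubnP n; elim: k n m w => // k IHk n m w.
rewrite ltnS => le_nk Sn m_gt0 wP; have n_gt0 := prim_order_gt0 wP.
have a1 : (a m).[1]%:~R = (map_poly intr (a m)).[1 : F].
  by rewrite -(rmorph1 intr) horner_map.
have [n1|n_neq1] := eqVneq n 1%N.
  by rewrite a1 n1 mul1n -(prim_expr_order wP) n1.
have w1 : w != 1.
  apply: contra_neq n_neq1 => w1; apply/eqP.
  by rewrite -dvdn1 (prim_order_dvd wP) w1 expr1n.
have [h] := ga n m Sn m_gt0.
move/(congr1 (fun P => (map_poly (intr : int -> F) P).[w])).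
rewrite rmorphM hornerM /= map_qint.
rewrite qint_root // ?(prim_expr_order wP) // mul0r rmorph_sum horner_sum /=.
have E d : (map_poly intr (mobius d *: (a (n * m %/ d)%N \Po 'X^d))).[w]
         = (mobius d)%:~R * (map_poly intr (a (n * m %/ d)%N)).[w ^+ d].
  by rewrite map_polyZ hornerZ map_comp_poly map_polyXn horner_comp hornerXn.
rewrite (bigD1_seq 1%N) ?divisors_uniq ?divisor1 //= E.
rewrite mobius1 mul1r divn1 expr1.
rewrite big_seq_cond (eq_bigr (fun d => (mobius d)%:~R * (a m).[1]%:~R)).
  rewrite -big_seq_cond -mulr_suml -rmorph_sum.
  have := sum_mobius n_gt0; rewrite (negPf n_neq1).
  rewrite (bigD1_seq 1%N) ?divisors_uniq ?divisor1 //= mobius1.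
  move/eqP; rewrite addrC addr_eq0 => /eqP->.
  by rewrite rmorphN rmorph1 mulN1r => /eqP; rewrite subr_eq0 => /eqP.
move=> d /andP[]; rewrite -dvdn_divisors // => d_n d1; rewrite E; congr (_ * _).
have d_gt0 := dvdn_gt0 n_gt0 d_n.
have nd_n : (n %/ d %| n)%N by rewrite -{2}(divnK d_n) dvdn_mulr.
rewrite -divn_mulAC // IHk //; first last.
- by move: (exp_prim_root wP d); rewrite (gcdn_idPl d_n).
- exact: pnat_dvd nd_n Sn.
by apply: leq_trans le_nk; rewrite ltn_Pdiv // ltn_neqAle eq_sym d1.
Qed.

(** * Taylor coefficients and the polynomials $P_{n,i}$ and $R_{n,i,j}$ *)

Definition shift_poly (A : comNzRingType) (w s : A) (p : {poly A}) : {poly A} :=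
  p \Po (w%:P + s *: 'X).

Lemma coef_shift_poly (A : comNzRingType) (w s : A) p k :
  k`!%:R * (shift_poly w s p)`_k = s ^+ k * p^`(k).[w].
Proof.
(* The width [size p + k.+1] makes the index [k] occur in the Taylor sum even beyond the degree of
   [p]. *)
rewrite /shift_poly /comp_poly (@nderiv_taylor_wide _ (size p + k.+1));
  first last.
- by rewrite size_map_polyC leq_addr.
- exact: mulrC.
have lt_k : (k < size p + k.+1)%N by rewrite addnS ltnS leq_addl.
rewrite coef_sum (bigD1 (Ordinal lt_k)) //= big1 ?addr0 => [|i i_k].
  rewrite nderivn_map horner_map /= exprZn -scalerAr coefZ coefCM coefXn eqxx.
  by rewrite mulr1 nderivn_def hornerMn mulrCA mulr_natl.
rewrite nderivn_map horner_map /= exprZn -scalerAr coefZ coefCM coefXn.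
by rewrite eq_sym (negPf i_k : (i == k :> nat) = false) !mulr0.
Qed.

(** For [j < i - n] the binomial coefficient vanishes, so the sum may start at 0, which suits the
    index shift in the recursion. *)
Lemma PpolyE (A : comNzRingType) n i :
  Ppoly A n i = i`!%:R * \sum_(0 <= j < i)
    'C(n, i - j)%:R * (- 'X) ^+ j * ('X - 1) ^+ (i - j - 1)%N.
Proof.
rewrite [in RHS](big_cat_nat (leq0n (i - n)%N)) ?leq_subr //=; congr (_ * _).
rewrite [X in _ = X + _]big_nat [X in _ = X + _]big1 ?add0r //.
move=> j /andP[_ lt_j].
by rewrite bin_small ?mul0r //; lia.
Qed.

Lemma Ppoly0 (A : comNzRingType) n : Ppoly A n 0 = 0.
Proof. by rewrite PpolyE big_geq ?mulr0. Qed.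

(** The term [j = 0] yields the falling factorial, and the others are [- 'X] times the sum for [i].
    The scaled Taylor coefficients of $[n]$ obey the same recursion. *)
Lemma PpolyS (A : comNzRingType) n i :
  Ppoly A n i.+1 + i.+1%:R * 'X * Ppoly A n i =
  (n ^_ i.+1)%:R * ('X - 1) ^+ i.
Proof.
rewrite !PpolyE big_nat_recl // !subn0 expr0 mulr1 subn1 /= mulrDr.
rewrite mulrA -natrM mulnC bin_ffact -[RHS]addr0 -addrA; congr (_ + _).
set s := \sum_(0 <= j < i) 'C(n, i - j)%:R * (- 'X) ^+ j * _.
rewrite [X in i.+1`!%:R * X](_ : _ = - 'X * s).
  by rewrite factS natrM; ring.
rewrite mulr_sumr; apply: eq_bigr => j _.
by rewrite !subSS exprS mulrCA -[LHS]mulrA.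
Qed.

Lemma size_natr_mul_leq (A : nzRingType) k (p : {poly A}) :
  (size (k%:R * p)%R <= size p)%N.
Proof. by rewrite -polyC_natr mul_polyC size_scale_leq. Qed.

Lemma size_Ppoly (A : comNzRingType) n i : (size (Ppoly A n i) <= i)%N.
Proof.
apply: leq_trans (size_natr_mul_leq _ _) _; rewrite big_nat.
apply: (big_ind (fun p : {poly A} => size p <= i)%N).
- by rewrite size_poly0.
- by move=> p q hp hq; apply: leq_trans (size_polyD _ _) _; rewrite geq_max hp.
move=> j /andP[_ lt_ji]; rewrite -mulrA.
apply: leq_trans (size_natr_mul_leq _ _) _.
apply: leq_trans (size_polyMleq _ _) _.
have := size_poly_exp_leq (- 'X : {poly A}) j.
have := size_poly_exp_leq ('X - 1%:P : {poly A}) (i - j - 1).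
rewrite size_XsubC size_polyN size_polyX /= !mul1n.
move: (size _) (size _) => x y; lia.
Qed.

Lemma coef_exp_congr (A : comNzRingType) (p q : {poly A}) j i :
  (forall k, (k <= j)%N -> p`_k = q`_k) ->
  forall k, (k <= j)%N -> (p ^+ i)`_k = (q ^+ i)`_k.
Proof.
move=> pq; elim: i => [|i IHi] k le_kj; first by rewrite !expr0.
rewrite !exprS !coefM; apply: eq_bigr => l _.
have := ltn_ord l; rewrite ltnS => le_lk.
by rewrite pq ?IHi //; lia.
Qed.

(** The quotient in [multinomial] is exact, since $x!\,y!$ divides $(x+y)!$. *)
Lemma multinomialK i j (a : 'I_i -> nat) : (\sum_(k < i) a k = j)%N ->
  (multinomial j a * \prod_(k < i) (a k)`! = j`!)%N.
Proof.
move=> <-; rewrite /multinomial divnK //.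
apply: (big_ind2 (fun x y => x %| y`!)%N) => // x1 y1 x2 y2 h1 h2.
apply: dvdn_trans (dvdn_mul h1 h2) _.
by rewrite -(bin_fact (leq_addr y2 y1)) addKn dvdn_mull.
Qed.

(** Multinomial expansion: if the $P_{n,k}(w)/k!$ are the coefficients of [U], the $R_{n,i,j}(w)/j!$
    are those of [U ^+ i]. *)
Lemma Rpoly_horner (A : comNzRingType) (w : A) (U : {poly A}) n i j :
  (forall k, (k <= j)%N -> (Ppoly A n k).[w] = k`!%:R * U`_k) ->
  (Rpoly A n i j).[w] = j`!%:R * (U ^+ i)`_j.
Proof.
(* Truncating [U] after degree [j] makes its [i]-th power a sum over functions from ['I_i] to
   ['I_j.+1], the index type of [Rpoly]. *)
move=> PU; pose W := \sum_(k < j.+1) U`_k *: 'X^k.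
have UW k : (k <= j)%N -> U`_k = W`_k.
  by rewrite /W -poly_def coef_poly ltnS => ->.
rewrite (coef_exp_congr i UW) //.
have -> : W ^+ i = \prod_(k < i) W by rewrite prodr_const card_ord.
rewrite /W bigA_distr_bigA coef_sum mulr_sumr horner_sum.
rewrite [RHS](bigID (fun f : {ffun 'I_i -> 'I_j.+1} => (\sum_k f k)%N == j)) /=.
rewrite [X in _ + X]big1 ?addr0 => [|f /negPf fj].
  apply: eq_bigr => f /eqP fj.
  rewrite scaler_prod prodrXr coefZ coefXn fj eqxx mulr1.
  rewrite -(multinomialK fj) natrM -mulrA hornerM hornerMn horner_prod.
  rewrite -{1}[1]/(1%:P) hornerC; congr (_ * _).
  rewrite natr_prod -big_split /=; apply: eq_bigr => k _.
  by rewrite PU // -ltnS ltn_ord.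
by rewrite scaler_prod prodrXr coefZ coefXn eq_sym fj !mulr0.
Qed.

(** The factor for a part $a_k$ has degree at most $a_k - 1$, so a product has degree at most $j -
    i$. For $i > j$ some part is 0 and its factor vanishes. *)
Lemma size_Rpoly (A : comNzRingType) n i j :
  (size (Rpoly A n i j) <= j.+1 - i)%N.
Proof.
rewrite /Rpoly.
apply: (big_ind (fun p : {poly A} => size p <= j.+1 - i)%N).
- by rewrite size_poly0.
- by move=> p q hp hq; apply: leq_trans (size_polyD _ _) _; rewrite geq_max hp.
move=> f /eqP fj; apply: leq_trans (size_natr_mul_leq _ _) _.
apply: leq_trans (size_poly_prod_leq _ _) _.
rewrite cardE size_enum_ord; apply: leq_sub2r; rewrite ltnS.
have /leq_trans-> // : (\sum_k size (Ppoly A n (f k)) <= \sum_k f k)%N;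
  last by rewrite fj.
by apply: leq_sum => k _; apply: size_Ppoly.
Qed.

Lemma shift_polyM (A : comNzRingType) (w s : A) (p q : {poly A}) :
  shift_poly w s (p * q) = shift_poly w s p * shift_poly w s q.
Proof. exact: rmorphM. Qed.

(** Writing $p = vX$ gives $p^i = v^i X^i$. *)
Lemma coef_exp_low (A : comNzRingType) (p : {poly A}) i k :
  p`_0 = 0 -> (k <= i)%N -> (p ^+ i)`_k = p`_1 ^+ i *+ (k == i).
Proof.
move=> p0; have /factor_theorem[v ->] : root p 0.
  by rewrite rootE horner_coef0 p0.
rewrite subr0 => le_ki; rewrite exprMn coefMXn coefMX /=.
case: ltngtP le_ki => // -> _; rewrite subnn; elim: i => [|i IHi].
  by rewrite !expr0 coef1.
by rewrite !exprS coef0M IHi.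
Qed.

Lemma big_ord_trunc (V : nmodType) (g : nat -> V) M N : (M <= N)%N ->
  (forall k, (M <= k)%N -> g k = 0) -> \sum_(k < N) g k = \sum_(k < M) g k.
Proof.
move=> le_MN g0; rewrite (big_ord_widen _ _ le_MN) [RHS]big_mkcond.
by apply: eq_bigr => k _; case: ltnP => // /g0.
Qed.

(** * Derivatives of digit expansions at a root of unity $w \ne 1$ *)

Section Derivatives.

Variables (F : fieldType) (n : nat) (w : F).
Hypotheses (w_unity : w ^+ n = 1) (w_neq1 : w != 1).

(** The factor [w] absorbs the negative powers of [w] from differentiating $X^n$, and [w - 1] clears
    the denominators, so that the Taylor coefficients of $[n]$ become polynomial in [w]. *)
Let s : F := w * (w - 1).
Let U : {poly F} := shift_poly w s (qint F n).

(* Taylor coefficients of [(X - 1) [n] = X^n - 1] at [w], scaled by [s]. *)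
Lemma qint_shift_rec k :
  k.+1`!%:R * U`_k.+1 + k.+1%:R * w * (k`!%:R * U`_k)
  = (n ^_ k.+1)%:R * (w - 1) ^+ k.
Proof.
have w1 : w - 1 != 0 by rewrite subr_eq0.
apply: (mulfI w1).
have coefXn1 : k.+1`!%:R * (shift_poly w s ('X^n - 1))`_k.+1
         = (n ^_ k.+1)%:R * (w - 1) ^+ k.+1.
  rewrite coef_shift_poly derivnB derivnXn -[1]/(1%:P : {poly F}).
  rewrite [X in _ - X]derivSn derivC linear0 subr0 hornerMn hornerXn.
  have [le_kn|lt_nk] := leqP k.+1 n; last first.
    by rewrite ffact_small // mulr0n mulr0 mul0r.
  (* The power of [w] in [s ^+ k.+1] completes [w ^+ (n - k.+1)] to [w ^+ n = 1]. *)
  rewrite mulrnAr -mulr_natl /s exprMn mulrAC -exprD subnKC //.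
  by rewrite w_unity mul1r.
have shiftX1 : shift_poly w s ('X - 1) = (w - 1)%:P + s *: 'X.
  by rewrite /shift_poly rmorphB rmorph1 /= comp_polyX polyCB addrAC.
move: coefXn1; rewrite -qintE shift_polyM -/U shiftX1 mulrDl coefD coefCM.
rewrite -scalerAl coefZ coefXM /= exprS => E.
by rewrite [RHS]mulrCA -E /s factS natrM; ring.
Qed.

(** Both sides satisfy the same first-order recursion and vanish at [k = 0]. *)
Lemma Ppoly_horner k : (Ppoly F n k).[w] = k`!%:R * U`_k.
Proof.
elim: k => [|k IHk].
  by rewrite Ppoly0 coef_shift_poly horner0 derivn0 qint_root ?mulr0.
move: IHk (PpolyS F n k); move: (Ppoly F n k) (Ppoly F n k.+1) => P P' PE.
move=> /(congr1 (horner^~ w)); rewrite -!polyC_natr !hornerE PE -qint_shift_rec.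
exact: addIr.
Qed.

Lemma qint_shift_coef0 : U`_0 = 0.
Proof. by have := Ppoly_horner 0; rewrite Ppoly0 horner0 mul1r. Qed.

Lemma qint_shift_coef1 : U`_1 = n%:R.
Proof.
have := qint_shift_rec 0.
by rewrite qint_shift_coef0 !mulr0 addr0 mul1r mulr1 ffactn1.
Qed.

(** The contribution of digit [m1] to the [i]-th derivative. Allowing [m1 = i] also covers the
    leading term $i!\,n^i f_i$. *)
Definition digit_term (f : {poly F}) (i m1 : nat) : {poly F} :=
  \sum_(m1 <= m2 < i.+1)
    'C(i, m2)%:R * f^`(i - m2) * Rpoly F n m1 m2
      * ('X - 1) ^+ (i - m2)%N * 'X^(i - m2).

(** Leibniz rule, read as a Cauchy product of shifted polynomials. Terms with [j < m1] vanish
    because $[n]$ is 0 at [w]. *)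
Lemma digit_term_horner (f : {poly F}) i m1 : (m1 <= i)%N ->
  (digit_term f i m1).[w] = s ^+ i * (f * qint F n ^+ m1)^`(i).[w].
Proof.
move=> le_m1i; rewrite -coef_shift_poly shift_polyM coefMr.
have -> : shift_poly w s (qint F n ^+ m1) = U ^+ m1 by apply: rmorphXn.
pose c j := (shift_poly w s f)`_(i - j) * (U ^+ m1)`_j.
rewrite -(big_mkord predT c) /c.
rewrite (big_cat_nat (leq0n m1)) ?leqW //= big_nat big1 ?add0r; last first.
  move=> j /andP[_ lt_j].
  by rewrite coef_exp_low ?qint_shift_coef0 ?(ltnW lt_j) // ltn_eqF ?mulr0.
rewrite mulr_sumr horner_sum big_nat [RHS]big_nat; apply: eq_bigr => j.
rewrite ltnS => /andP[_ le_ji]; rewrite !hornerM hornerXn horner_exp.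
rewrite (Rpoly_horner (U := U)) => [|k _]; last exact: Ppoly_horner.
rewrite -polyC_natr !hornerE -(bin_fact le_ji) !natrM /=.
transitivity ('C(i, j)%:R * (s ^+ (i - j) * f^`(i - j).[w])
              * (j`!%:R * (U ^+ m1)`_j)).
  by rewrite /s exprMn; ring.
by rewrite -coef_shift_poly; ring.
Qed.

Lemma digits_horner (b : {poly F}) (f : nat -> {poly F}) i :
  is_qdigits n b f ->
  s ^+ i * b^`(i).[w] =
  i`!%:R * n%:R ^+ i * (f i).[w]
  + \sum_(0 <= m1 < i) (digit_term (f m1) i m1).[w].
Proof.
move=> [_ [N [f0 ->]]].
pose g m1 := s ^+ i * (f m1 * qint F n ^+ m1)^`(i).[w].
have -> : s ^+ i * (\sum_(m1 < N) f m1 * qint F n ^+ m1)^`(i).[w]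
          = \sum_(m1 < N) g m1.
  by rewrite linear_sum horner_sum mulr_sumr.
(* If [N] exceeds [i], the extra terms vanish to order above [i] at [w]; otherwise the added digits
   are 0. *)
have -> : \sum_(m1 < N) g m1 = \sum_(m1 < i.+1) g m1.
  have [le_iN|/ltnW le_Ni] := leqP i.+1 N.
    apply: big_ord_trunc => // k lt_ik.
    rewrite /g -coef_shift_poly shift_polyM.
    have -> : shift_poly w s (qint F n ^+ k) = U ^+ k by apply: rmorphXn.
    rewrite coefMr big1 ?mulr0 // => j _.
    have := ltn_ord j; rewrite ltnS => le_ji.
    rewrite coef_exp_low ?qint_shift_coef0 ?ltn_eqF ?mulr0 //.
      exact: leq_ltn_trans lt_ik.
    by apply/ltnW/(leq_ltn_trans le_ji).
  apply/esym/big_ord_trunc => // k /f0 fk.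
  by rewrite /g fk mul0r linear0 horner0 mulr0.
rewrite big_ord_recr big_mkord [RHS]addrC /=; congr (_ + _).
  by apply: eq_bigr => m1 _; rewrite digit_term_horner // ltnW.
(* For [m1 = i] only [m2 = i] remains, and $R_{n,i,i}(w) = i!\,n^i$. *)
rewrite /g -digit_term_horner // /digit_term big_nat1 subnn binn.
rewrite !expr0 !mulr1 mul1r derivn0 hornerM (Rpoly_horner (U := U)).
  rewrite coef_exp_low ?qint_shift_coef0 // eqxx mulr1n qint_shift_coef1.
  exact: mulrC.
by move=> k _; apply: Ppoly_horner.
Qed.

End Derivatives.

(** * Degree bounds, values at 1, and interpolation *)

Lemma size_derivn_leq (A : nzRingType) (p : {poly A}) k :
  (size p^`(k) <= size p - k)%N.
Proof.
apply/leq_sizeP => j le_j; rewrite coef_derivn nth_default ?mul0rn //.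
by rewrite -leq_subLR.
Qed.

(** The degrees add up to $\deg f - (i - m_2) + (m_2 - m_1) + 2(i - m_2) = \deg f + i - m_1$,
    independently of $m_2$. *)
Lemma size_digit_term (F : fieldType) n (f : {poly F}) i m1 : (m1 <= i)%N ->
  (size (digit_term n f i m1) <= size f + i - m1)%N.
Proof.
move=> le_m1i; rewrite /digit_term big_nat.
apply: (big_ind (fun p : {poly F} => size p <= size f + i - m1)%N).
- by rewrite size_poly0.
- by move=> p q hp hq; apply: leq_trans (size_polyD _ _) _; rewrite geq_max hp.
move=> m2; rewrite ltnS => /andP[le_m1m2 le_m2i].
have [->|df0] := eqVneq f^`(i - m2) 0; first by rewrite mulr0 !mul0r size_poly0.
have := size_derivn_leq f (i - m2); move: df0; rewrite -size_poly_gt0.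
move: f^`(i - m2) => df df_gt0 size_df.
have := size_Rpoly F n m1 m2; move: (Rpoly F n m1 m2) => R12 size_R12.
rewrite -!mulrA; apply: leq_trans (size_natr_mul_leq _ _) _; rewrite !mulrA.
have := size_poly_exp_leq ('X - 1%:P : {poly F}) (i - m2).
rewrite size_XsubC /= mul1n => size_X1.
apply: leq_trans (size_polyMleq _ _) _; rewrite size_polyXn.
have := size_polyMleq (df * R12) (('X - 1) ^+ (i - m2)).
have := size_polyMleq df R12.
move: (size (df * R12)) (size (df * R12 * _)) size_X1 => x y.
move: (size (('X - 1%:P) ^+ _)) => z.
move: (size df) (size R12) (size f) df_gt0 size_df size_R12 => u v t.
lia.
Qed.

(** Terms with [m2 < i] contain the factor ['X - 1]. For [m2 = i], either [f] vanishes at 1, or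
    [m1 = 0] and $R_{n,0,i} = 0$ since $i > 0$. *)
Lemma digit_term_root1 (F : fieldType) n (f : {poly F}) i m1 :
  (m1 < i)%N -> (m1 != 0%N -> f.[1] = 0) -> (digit_term n f i m1).[1] = 0.
Proof.
move=> lt_m1i f1; rewrite horner_sum big_nat big1 // => m2.
rewrite ltnS => /andP[_ le_m2i].
rewrite !hornerM horner_exp !hornerE subrr expr0n subn_eq0.
case: leqP => [le_im2|]; last by rewrite mulr0 mul0r.
have -> : (i - m2 = 0)%N by apply/eqP; rewrite subn_eq0.
rewrite derivn0; have [m10|m1_neq0] := eqVneq m1 0%N; last first.
  by rewrite f1 // mulr0 !mul0r.
rewrite m10 /Rpoly big_pred0 ?horner0 ?mulr0 ?mul0r // => c.
by rewrite big_ord0 eq_sym gtn_eqF //; lia.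
Qed.

(** The difference has degree at most $n - 2$ but $n - 1$ distinct roots. *)
Lemma eq_poly_unity_root (F : fieldType) n (w : F) (p q : {poly F}) :
  n.-primitive_root w -> (size p < n)%N -> (size q < n)%N ->
  (forall j, (0 < j < n)%N -> p.[w ^+ j] = q.[w ^+ j]) -> p = q.
Proof.
move=> wP szp szq pq; apply/eqP; rewrite -subr_eq0; apply/eqP.
apply: (@roots_geq_poly_eq0 _ _ [seq w ^+ j | j <- iota 1 n.-1]).
- apply/allP => x /mapP[j]; rewrite mem_iota => j_n ->.
  by rewrite rootE hornerD hornerN pq ?subrr //; lia.
- rewrite map_inj_in_uniq ?iota_uniq // => j k.
  rewrite !mem_iota => j_n k_n /eqP.
  by rewrite (eq_prim_root_expr wP) !modn_small => [/eqP||] //; lia.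
rewrite size_map size_iota; apply: leq_trans (size_polyD _ _) _.
have le_pred k : (k < n)%N -> (k <= n.-1)%N by lia.
by rewrite size_polyN geq_max !le_pred.
Qed.

Lemma divp_qint (F : fieldType) n d : (0 < n)%N -> (d %| n)%N ->
  qint F n %/ qint F (n %/ d) = qint F d \Po 'X^(n %/ d).
Proof.
move=> n_gt0 d_n; have d_gt0 := dvdn_gt0 n_gt0 d_n.
rewrite -{1}(divnK d_n) qint_comp mulKp //.
have nd_gt0 : (0 < n %/ d)%N by rewrite divn_gt0 // dvdn_leq.
by have [/monic_neq0] := monic_qint F nd_gt0.
Qed.

(** * The interpolating polynomial $G_{g,n}$ *)

Section Gpoly.

Variables (R : realType) (g : nat -> R[i]) (n : nat).
Hypothesis n_gt0 : (0 < n)%N.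

Let mobius_sum d := \sum_(e <- divisors d) (mobius (d %/ e))%:~R * g e.

Lemma GpolyE : Gpoly g n = \sum_(d <- proper_divisors n)
  (mobius_sum d / d%:R) *: (qint R[i] d \Po 'X^(n %/ d)).
Proof.
rewrite /Gpoly big_seq [RHS]big_seq; apply: eq_bigr => d.
by rewrite mem_filter -dvdn_divisors // => /andP[_ d_n]; rewrite divp_qint.
Qed.

Lemma Gpoly_horner1 :
  (Gpoly g n).[1] = \sum_(d <- proper_divisors n) mobius_sum d.
Proof.
rewrite GpolyE horner_sum big_seq [RHS]big_seq; apply: eq_bigr => d.
rewrite mem_filter -dvdn_divisors // => /andP[_ /(dvdn_gt0 n_gt0) d_gt0].
rewrite hornerZ horner_comp hornerXn expr1n qint_horner1 divfK //.
by rewrite pnatr_eq0 -lt0n.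
Qed.

(** The factor $[d](w^{jn/d})$ is $d$ if $d \mid j$ and 0 otherwise. The surviving $d$ are all the
    divisors of $\gcd(j,n)$, which are proper in [n] because $0 < j < n$, and Möbius inversion
    applies. *)
Lemma Gpoly_horner_unity w j : n.-primitive_root w -> (0 < j < n)%N ->
  (Gpoly g n).[w ^+ j] = g (gcdn j n).
Proof.
move=> wP /andP[j_gt0 lt_jn].
have gcd_gt0 : (0 < gcdn j n)%N by rewrite gcdn_gt0 j_gt0.
rewrite -(mobius_inversion g gcd_gt0) GpolyE horner_sum.
rewrite (bigID (fun d => (d %| j)%N)) /= [X in _ + X]big_seq_cond.
rewrite [X in _ + X]big1 ?addr0 => [|d].
  rewrite -big_filter big_seq; set s1 := [seq _ <- _ | _].
  have s1P d : d \in s1 -> (d %| j)%N && (d %| n)%N.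
    by rewrite !mem_filter -dvdn_divisors // => /and3P[-> _ ->].
  rewrite (eq_bigr mobius_sum) => [|d /s1P/andP[d_j d_n]].
    rewrite -big_seq; apply: perm_big; apply: uniq_perm.
    - by rewrite !filter_uniq ?divisors_uniq.
    - exact: divisors_uniq.
    move=> d; rewrite !mem_filter -!dvdn_divisors // dvdn_gcd.
    case: (boolP (d %| j)%N) => //= d_j; rewrite andb_idl // => _.
    by rewrite ltn_eqF // (leq_ltn_trans _ lt_jn) // dvdn_leq.
  rewrite hornerZ horner_comp hornerXn -exprM.
  have -> : w ^+ (j * (n %/ d)) = 1.
    apply/eqP; rewrite -(prim_order_dvd wP) -{1}(divnK d_n) mulnC.
    by rewrite dvdn_mul.
  by rewrite qint_horner1 divfK // pnatr_eq0 -lt0n (dvdn_gt0 n_gt0).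
rewrite mem_filter -dvdn_divisors // => /andP[/andP[_ d_n] d_j].
have nd_gt0 : (0 < n %/ d)%N by rewrite divn_gt0 ?(dvdn_gt0 n_gt0) // dvdn_leq.
rewrite hornerZ horner_comp hornerXn -exprM qint_root ?mulr0 //.
  by rewrite -exprM -mulnA divnK // mulnC exprM (prim_expr_order wP) expr1n.
apply: contra d_j; rewrite -(prim_order_dvd wP) -{1}(divnK d_n) mulnC.
by rewrite dvdn_pmul2r.
Qed.

(** The term of [d] has degree at most $n - n/d$, and $n/d \ge p$ for a proper divisor. *)
Lemma size_Gpoly : (size (Gpoly g n) + pdiv n <= n.+1)%N.
Proof.
rewrite GpolyE big_seq.
apply: (big_ind (fun p : {poly R[i]} => size p + pdiv n <= n.+1)%N).
- by rewrite size_poly0 ltnW // ltnS pdiv_leq.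
- move=> p q hp hq; have := size_polyD p q.
  by move: (size (p + q)%R) => x; rewrite leq_max => /orP[]; lia.
move=> d; rewrite mem_filter -dvdn_divisors // => /andP[d_neqn d_n].
have d_gt0 := dvdn_gt0 n_gt0 d_n.
have le_pnd : (pdiv n <= n %/ d)%N.
  apply: pdiv_min_dvd; last by rewrite -{2}(divnK d_n) dvdn_mulr.
  by rewrite ltn_divRL // mul1n ltn_neqAle d_neqn dvdn_leq.
have := size_scale_leq (mobius_sum d / d%:R) (qint R[i] d \Po 'X^(n %/ d)).
have := size_comp_poly_leq (qint R[i] d) 'X^(n %/ d).
have [_ ->] := monic_qint R[i] d_gt0; rewrite size_polyXn /=.
move: (size _) (size _) => x y hx hy; have := divnK d_n; nia.
Qed.

End Gpoly.

(** * Digit expansions over the integers *)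

Lemma int_qdigits_exist n (P : {poly int}) : (1 < n)%N ->
  exists h : nat -> {poly int}, (forall i, (size (h i) < n)%N) /\
  exists N : nat, (forall i, (N <= i)%N -> h i = 0) /\
    P = \sum_(i < N) h i * qint int n ^+ i.
Proof.
move=> n_gt1; have [Q_monic szQ] := monic_qint int (ltnW n_gt1).
have [s] := ubnP (size P); elim: s P => // s IHs P; rewrite ltnS => le_Ps.
(* As $[n]$ is monic, division with remainder stays over the integers. *)
have PE := Pdiv.RingMonic.rdivp_eq Q_monic P.
have := Pdiv.Ring.ltn_rmodpN0 P (monic_neq0 Q_monic); rewrite szQ.
move: (Pdiv.Ring.rdivp _ _) (Pdiv.Ring.rmodp _ _) PE => q r PE szr.
have [q0|q_neq0] := eqVneq q 0.
  exists (fun i => if i is 0%N then r else 0); split.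
    by case=> [|i] //; rewrite size_poly0 ltnW.
  exists 1%N; split; first by case.
  by rewrite big_ord1 expr0 mulr1 PE q0 mul0r add0r.
have [|h [szh [N [h0 qE]]]] := IHs q.
  have szqQ := size_Mmonic q_neq0 Q_monic; rewrite szQ in szqQ.
  move: q_neq0; rewrite -size_poly_gt0 => q_gt0.
  by apply: leq_trans le_Ps; rewrite PE size_polyDl szqQ;
    move: (size q) (size r) q_gt0 szr => x y; lia.
exists (fun i => if i is i'.+1 then h i' else r); split; first by case.
exists N.+1; split; first by case=> // i; rewrite ltnS => /h0.
rewrite big_ord_recl expr0 mulr1 PE addrC qE mulr_suml; congr (_ + _).
by apply: eq_bigr => i _; rewrite exprSr mulrA.
Qed.

(** * The recursion, divisibility by $q - 1$, and the congruence *)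

Section Main.

Variables (R : realType) (S : nat_pred) (r : nat) (a : nat -> {poly int}).
Variables (n m : nat).
Hypothesis a_gauss : q_gauss_order R r S a.
Hypotheses (n_ge2 : (2 <= n)%N) (m_ge1 : (1 <= m)%N) (n_S : S.-nat n).

Let w := omega R n.
Let b := polyC_of R (a (m * n)%N).
Let g (i d : nat) : R[i] := (w ^+ d) ^+ i * b^`(i).[w ^+ d].

Let n_gt0 : (0 < n)%N := ltnW n_ge2.
Let w_prim : n.-primitive_root w := omega_prim R n_gt0.

Lemma order_S j : S.-nat (n %/ gcdn j n)%N.
Proof.
apply: pnat_dvd n_S.
by rewrite -[X in (_ %| X)%N](divnK (dvdn_gcdr j n)) dvdn_mulr.
Qed.

(** The root [w ^+ j] has order $n/\gcd(j,n)$, and $mn$ is this order times $m \gcd(j,n)$, so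
    [q_gauss_value] applies. *)
Lemma value_at_root j : b.[w ^+ j] = (a (m * gcdn j n)%N).[1]%:~R.
Proof.
rewrite -(q_gauss_value a_gauss.1 (order_S j) _ (exp_prim_root w_prim j)).
  by rewrite /b /polyC_of mulnCA divnK ?dvdn_gcdr.
by rewrite muln_gt0 m_ge1 gcdn_gt0 n_gt0 orbT.
Qed.

(** The two roots involved have the same order. The case [i = 0] comes from the $q$-Gauss
    congruences, the others from the order-[r] hypothesis. *)
Lemma derivative_at_root i j : (i <= r - 1)%N -> g i j = g i (gcdn j n).
Proof.
case: i => [|i] le_ir; rewrite /g.
  by rewrite !mul1r !derivn0 !value_at_root -gcdnA gcdnn.
rewrite /b mulnC.
apply: (a_gauss.2 m n i.+1 m_ge1 n_S _ (n %/ gcdn j n)%N) => //.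
- by exists j%:Z; rewrite exprnP.
- by exists (gcdn j n)%:Z; rewrite exprnP.
- exact: exp_prim_root.
have := exp_prim_root w_prim (gcdn j n).
by rewrite (gcdn_idPl (dvdn_gcdr j n)).
Qed.

(** Recursion and degree bound are proved in one strong induction: bounding the right-hand side uses
    the bounds for the earlier digits. *)
Lemma digit_rec (f : nat -> {poly R[i]}) i :
  is_qdigits n b f -> (i <= minn (pdiv n - 2) (r - 1))%N ->
  f i = (i`!%:R * n%:R ^+ i)^-1 *:
    (('X - 1) ^+ i * Gpoly (g i) n
     - \sum_(0 <= m1 < i) digit_term n (f m1) i m1)
  /\ (size (f i) + pdiv n <= n + i.+1)%N.
Proof.
move=> f_dig; have [k] := ubnP i; elim: k i => // k IHk i.
rewrite ltnS leq_min => le_ik /andP[le_ip le_ir].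
set rhs := _ *: _.
have p_gt1 : (1 < pdiv n)%N by rewrite prime_gt1 // pdiv_prime.
have size_rhs : (size rhs + pdiv n <= n + i.+1)%N.
  have bnd (p : {poly R[i]}) : (size p <= n + i.+1 - pdiv n)%N ->
      (size p + pdiv n <= n + i.+1)%N.
    by have := pdiv_leq n_gt0; lia.
  apply: bnd; apply: leq_trans (size_scale_leq _ _) _.
  apply: leq_trans (size_polyD _ _) _; rewrite size_polyN geq_max.
  apply/andP; split.
    apply: leq_trans (size_polyMleq _ _) _.
    have := size_poly_exp_leq ('X - 1%:P : {poly R[i]}) i.
    have := size_Gpoly (g i) n_gt0; rewrite size_XsubC mul1n.
    move: (size _) (size _) => x y; lia.
  rewrite big_nat; apply: (big_ind (fun p : {poly R[i]} => size p <= _)%N).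
  - by rewrite size_poly0.
  - move=> p q hp hq; apply: leq_trans (size_polyD _ _) _.
    by rewrite geq_max hp.
  move=> m1 /andP[_ lt_m1i].
  have [||_] := IHk m1; [by lia | by rewrite leq_min; lia |].
  have := size_digit_term n (f m1) (ltnW lt_m1i).
  move: (size _) (size _) => x y; lia.
have fE : f i = rhs.
  apply: (eq_poly_unity_root w_prim); first exact: f_dig.1.
    (* Here [i <= pdiv n - 2] enters: it brings the size, at most [n + i.+1 - pdiv n], below [n]. *)
    by move: (size rhs) size_rhs => x; have := pdiv_leq n_gt0; lia.
  move=> j /andP[j_gt0 lt_jn].
  have v_unity : (w ^+ j) ^+ n = 1.
    by rewrite exprAC (prim_expr_order w_prim) expr1n.
  have v_neq1 : w ^+ j != 1.
    by rewrite -(prim_order_dvd w_prim) gtnNdvd.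
  have c_neq0 : i`!%:R * n%:R ^+ i != 0 :> R[i].
    by rewrite mulf_neq0 ?expf_neq0 // pnatr_eq0 -lt0n ?fact_gt0.
  have := digits_horner v_unity v_neq1 i f_dig.
  rewrite exprMn mulrAC -[X in X * _]/(g i j) derivative_at_root //.
  rewrite -(Gpoly_horner_unity (g i) n_gt0 w_prim (j := j)) ?j_gt0 //.
  move=> E; apply: (mulfI c_neq0); rewrite /rhs hornerZ mulVKf //.
  rewrite hornerD hornerN hornerM horner_exp hornerXsubC.
  by rewrite [X in X - _]mulrC E horner_sum addrK.
by split; rewrite // fE.
Qed.

(** At 1 the power of ['X - 1] kills the term with [Gpoly], and by induction on [i] all earlier
    digit terms vanish. *)
Lemma digit_root1 (f : nat -> {poly R[i]}) i :
  is_qdigits n b f -> (0 < i <= minn (pdiv n - 2) (r - 1))%N -> (f i).[1] = 0.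
Proof.
move=> f_dig; have [k] := ubnP i; elim: k i => // k IHk i.
rewrite ltnS => le_ik /andP[i_gt0 le_iM].
have [-> _] := digit_rec f_dig le_iM.
rewrite hornerZ hornerD hornerN hornerM horner_exp hornerXsubC subrr.
rewrite expr0n gtn_eqF // mul0r horner_sum big_nat big1 ?subr0 ?mulr0 //.
move=> m1 /andP[_ lt_m1i]; apply: digit_term_root1 => //.
move=> m1_neq0; rewrite IHk //; first exact: leq_trans lt_m1i le_ik.
by rewrite lt0n m1_neq0 (leq_trans (ltnW lt_m1i)).
Qed.

Lemma mobius_sum_mod :
  ((n ^ (1 + minn (pdiv n - 2) (r - 1)))%N %|
    \sum_(d <- divisors n) mobius (n %/ d)%N * (a (m * d)%N).[1])%Z.
Proof.
set M := minn _ _.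
(* Starting from integer digits makes every $f_i(1)$ an integer. *)
have [h [szh [N [h0 aE]]]] := int_qdigits_exist (a (m * n)%N) n_ge2.
pose f i := polyC_of R (h i).
have f_dig : is_qdigits n b f.
  split=> [i|]; first exact: leq_ltn_trans (size_poly _ _) (szh i).
  exists N; split=> [i /h0|].
    by rewrite /f /polyC_of => ->; rewrite rmorph0.
  rewrite /b /polyC_of aE rmorph_sum; apply: eq_bigr => i _.
  by rewrite rmorphM rmorphXn /= map_qint.
have f1 i : (f i).[1] = (h i).[1]%:~R by rewrite -(rmorph1 intr) horner_map.
have h1 i : (0 < i <= M)%N -> (h i).[1] = 0.
  by move=> /(digit_root1 f_dig); rewrite f1 => /eqP; rewrite intr_eq0 => /eqP.
pose A d := (a (m * d)%N).[1].
have f0E : f 0%N = Gpoly (g 0) n.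
  have [-> _] := digit_rec f_dig (leq0n M).
  by rewrite big_geq // subr0 !mul1r invr1 scale1r.
have h0E : (h 0%N).[1] = \sum_(d <- proper_divisors n)
                          \sum_(e <- divisors d) (mobius (d %/ e))%:~R * A e.
  apply: (@intr_inj R[i]); rewrite -f1 f0E Gpoly_horner1 // rmorph_sum.
  rewrite big_seq [RHS]big_seq; apply: eq_bigr => d.
  rewrite mem_filter -dvdn_divisors // => /andP[_ d_n].
  rewrite rmorph_sum big_seq [RHS]big_seq; apply: eq_bigr => e.
  rewrite -dvdn_divisors ?(dvdn_gt0 n_gt0) // => e_d.
  rewrite rmorphM /= intz /g mul1r derivn0 value_at_root.
  by rewrite (gcdn_idPl (dvdn_trans e_d d_n)).
(* Splitting off [d = n] shows that the sum in question is $a_{mn}(1) - f_0(1)$. *)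
have := mobius_inversion A n_gt0.
rewrite (bigD1_seq n) ?divisors_uniq ?divisors_id //=.
rewrite -[X in _ + X]big_filter -h0E.
under eq_bigr do rewrite intz.
move/(canRL (addrK _)) => ->; rewrite /A aE horner_sum.
case: N {aE} h0 => [|N] h0; first by rewrite big_ord0 h0 // horner0 subrr dvdz0.
(* Digit 0 cancels, so [i] now stands for digit [i.+1]: it vanishes at 1 up to [M], and beyond that
   [n ^ i.+1] supplies the divisibility. *)
rewrite big_ord_recl expr0 mulr1 addrC addKr; apply: rpred_sum => i _.
rewrite hornerM horner_exp qint_horner1.
have [le_iM|lt_Mi] := leqP i.+1 M; first by rewrite h1 // mul0r dvdz0.
by rewrite dvdz_mull // natz dvdzE abszX dvdn_exp2l.
Qed.

End Main.

Theorem theorem2p6 (R : realType) (S : nat_pred) (r : nat)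
    (a : nat -> {poly int}) (n m : nat)
    (S_prime : forall p : nat, p \in S -> prime p)
    (r_gt0 : (0 < r)%N)
    (a_gauss : q_gauss_order R r S a)
    (n_ge2 : (2 <= n)%N) (m_ge1 : (1 <= m)%N) (n_S : S.-nat n) :
  let p := pdiv n in
  let b := polyC_of R (a (m * n)%N) in
  let g := fun i d : nat =>
    (omega R n ^+ d) ^+ i * b^`(i).[omega R n ^+ d] in
  (forall f : nat -> {poly R[i]}, is_qdigits n b f ->
     (forall i : nat, (i <= minn (p - 2) (r - 1))%N ->
        f i = (i`!%:R * n%:R ^+ i)^-1 *:
          (('X - 1) ^+ i * Gpoly (g i) n -
           \sum_(0 <= m1 < i) \sum_(m1 <= m2 < i.+1)
             'C(i, m2)%:R * (f m1)^`(i - m2) * Rpoly R[i] n m1 m2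
             * ('X - 1) ^+ (i - m2)%N * 'X^(i - m2)))
     /\ (forall i : nat, (1 <= i <= minn (p - 2) (r - 1))%N ->
          'X - 1 %| f i))
  /\ (\sum_(d <- divisors n) mobius (n %/ d)%N * (a (m * d)%N).[1] = 0
        %[mod (n ^ (1 + minn (p - 2) (r - 1)))%N])%Z.
Proof.
split; last first.
  apply/eqP; rewrite eqz_mod_dvd subr0.
  exact: mobius_sum_mod a_gauss n_ge2 m_ge1 n_S.
move=> f f_dig; split=> i i_le; last first.
  rewrite -['X - 1]/('X - 1%:P) dvdp_XsubCl rootE.
  by rewrite (digit_root1 a_gauss n_ge2 m_ge1 n_S f_dig).
exact: (digit_rec a_gauss n_ge2 m_ge1 n_S f_dig i_le).1.
Qed.
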